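(* Let $X$ be a set with $|X|>1$. The $\mathrm{id}$-matching structures on $(K\langle X\rangle^+,\cdot)$ are in a one-to-one correspondence with maps $\star:X\times X\to K\langle X\rangle^+$, $$(x,y)\mapsto x\star y=\sum_{u\in X}u\cdot R_{x,y,u}=\sum_{v\in X}L_{x,y,v}\cdot v,$$ where $R_{x,y,u},L_{x,y,v}\in K\langle X\rangle$ and $$\sum_{v\in X}L_{x,y,v}\cdot(v\star z)=\sum_{u\in X}(x\star u)\cdot R_{y,z,u}$$ for all $x,y,z\in X$.
   Context: All algebras and vector spaces are over a field $K$ and all products are binary and bilinear. $K\langle X\rangle$ is the free associative (unital) $K$-algebra over $X$, i.e. the semigroup algebra of the free monoid $X^*$ of all words over $X$ under concatenation, and $K\langle X\rangle^+$ is the free non-unital associative $K$-algebra over $X$, i.e. the semigroup algebra of the free semigroup $X^+$ of non-empty words over $X$; it is an ideal of $K\langle X\rangle$. The product in both algebras is denoted by $\cdot$. One has $K\langle X\rangle^+=\bigoplus_{x\in X}x\cdot K\langle X\rangle=\bigoplus_{x\in X}K\langle X\rangle\cdot x$, and the two expressions of $x\star y$ in the claim are its decompositions according to these two direct sums. An $\mathrm{id}$-matching structure on an associative algebra $(A,\cdot)$ is an associative product $*$ on $A$ such that $(a*b)\cdot c=a*(b\cdot c)$ and $(a\cdot b)*c=a\cdot(b*c)$ for all $a,b,c\in A$. *)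

(* Defs.v *)
From HB Require Import structures.
From mathcomp Require Import all_boot all_order all_algebra.
From mathcomp Require Import finmap monalg.
From mathcomp Require functions.

Set Implicit Arguments.
Unset Strict Implicit.
Unset Printing Implicit Defensive.

Import GRing.Theory.
Local Open Scope ring_scope.

(* K<X>: [{fmonom X}] is the free monoid X^*, with empty word [mone]. *)
Notation freealg K X := {malg K[{fmonom X}]}.

Section FreeNonunital.
Variables (K : fieldType) (X : choiceType).
Implicit Types f g : freealg K X.

Definition supp_nonempty : {pred freealg K X} :=
  fun f => @mone {fmonom X} \notin msupp f.

Lemma supp_nonemptyE f : (f \in supp_nonempty) = (f@_mone == 0).
Proof. by rewrite -topredE /= /supp_nonempty -mcoeff_eq0. Qed.

Fact supp_nonempty_submod : submod_closed supp_nonempty.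
Proof.
split=> [|c f g]; rewrite !supp_nonemptyE ?mcoeff0 //.
by rewrite mcoeffD mcoeffZ => /eqP-> /eqP->; rewrite mulr0 addr0.
Qed.

HB.instance Definition _ :=
  GRing.isSubmodClosed.Build K (freealg K X) supp_nonempty supp_nonempty_submod.

(* K<X>^+, realised as the span of X^+ = X^* \ {1} inside K<X>. *)
Record freealgp :=
  FreeAlgP { freealgp_val :> freealg K X; _ : freealgp_val \in supp_nonempty }.

HB.instance Definition _ := [isSub for freealgp_val].
HB.instance Definition _ := [Choice of freealgp by <:].
HB.instance Definition _ := [SubChoice_isSubLmodule of freealgp by <:].

Fact freealgp_mul_subproof (f g : freealgp) :
  freealgp_val f * freealgp_val g \in supp_nonempty.
Proof.
case: f g => [f Pf] [g Pg] /=; apply/negP => /msuppM_le [u] [v] [fu _ e].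
have [u1 _] := @unitm {fmonom X} u v (esym e).
by move: Pf; rewrite -topredE /= /supp_nonempty -u1 fu.
Qed.

Definition freealgp_mul (f g : freealgp) : freealgp :=
  FreeAlgP (freealgp_mul_subproof f g).

Fact letter_subproof (x : X) : << fmu x >> \in supp_nonempty.
Proof. by rewrite supp_nonemptyE mcoeffU fm1_eq1. Qed.

Definition letter (x : X) : freealgp := FreeAlgP (letter_subproof x).

End FreeNonunital.

Section Matching.
Variables (K : fieldType) (A : lmodType K).
Implicit Types m : A -> A -> A.

Definition assoc_product m : Prop :=
  bilinear_for *:%R *:%R m /\ associative m.

Definition id_matching (dot ast : A -> A -> A) : Prop :=
  [/\ assoc_product ast,
      forall a b c, dot (ast a b) c = ast a (dot b c)
    & forall a b c, ast (dot a b) c = dot a (ast b c)].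

End Matching.

Lemma freealgp_mul_assoc_product (K : fieldType) (X : choiceType) :
  assoc_product (@freealgp_mul K X).
Proof.
split; [split=> [g c f1 f2|f c g1 g2]|move=> f g h]; apply/val_inj => /=.
- by rewrite /= mulrDl -scalerAl.
- rewrite /= mulrDr; congr (_ + _).
  apply/malgP => w; rewrite mcoeffZ.
  rewrite (mcoeffMlw _ (fsubset_refl _) (msuppZ_le _ _)) mcoeffMl mulr_sumr.
  apply: eq_bigr => u _; rewrite mulr_sumr; apply: eq_bigr => v _.
  by rewrite mcoeffZ mulrCA mulrnAr.
- by rewrite /= mulrA.
Qed.

Section StarMaps.
Variables (K : fieldType) (X : choiceType).

(* The direct sum of copies of K<X> indexed by X: finitely supported families. *)
Local Notation coefs := {fsfun X -> freealg K X with 0}.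

(* The families R x y and L x y are determined by star x y, since K<X>^+ is the
   direct sum of the x * K<X>, and also that of the K<X> * x. *)
Definition star_compatible (star : X -> X -> freealgp K X) : Prop :=
  exists R L : X -> X -> coefs,
    [/\ forall x y, (star x y : freealg K X) =
          \sum_(u <- finsupp (R x y)) (letter K u : freealg K X) * R x y u,
        forall x y, (star x y : freealg K X) =
          \sum_(v <- finsupp (L x y)) L x y v * (letter K v : freealg K X)
      & forall x y z,
          \sum_(v <- finsupp (L x y)) L x y v * (star v z : freealg K X) =
          \sum_(u <- finsupp (R y z)) (star x u : freealg K X) * R y z u].

Definition letter_restriction
    (ast : freealgp K X -> freealgp K X -> freealgp K X) :
  X -> X -> freealgp K X :=
  fun x y => ast (letter K x) (letter K y).

End StarMaps.

(* Main.v *)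
Require Import Defs.
From HB Require Import structures.
From mathcomp Require Import all_boot all_order all_algebra.
From mathcomp Require Import finmap monalg.
From mathcomp Require boolp classical_sets.
From mathcomp Require functions.

(** The two mixed laws (a * b) . c = a * (b . c) and (a . b) * c = a . (b * c),
together with bilinearity, say that * : K<X>^+ x K<X>^+ -> K<X>^+ commutes with
left multiplication in its first argument, with right multiplication in its
second. Now K<X>^+ is free as a left K<X>-module, and also as
a right one, with basis X. Hence such a product is the same thing as an
arbitrary map X x X -> K<X>^+: on words it must be
(s x) * (y t) = s (x * y) t, where x * y is prescribed, and this formula, extended
bilinearly, always defines a product of this kind ([module_product_inj],
[extend_star_letters], [extend_star_module]).

It remains to see which of these products are associative. The two sides of
(a * b) * c = a * (b * c) both commute with left multiplication on a and with
right multiplication on c; if b = f . g is decomposable, they agree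
unconditionally:
(a * (f . g)) * c = (a * f) . (g * c) = a * ((f . g) * c).
So only triples of letters matter ([associative_on_letters]). For letters x, y, z,
writing x * y as a sum of the L_v . v gives (x * y) * z as the sum of the
L_v . (v * z), and writing y * z as a sum of the u . R_u gives x * (y * z) as the
sum of the (x * u) . R_u; so associativity on letters is exactly the
compatibility condition ([star_compatible_assoc]). *)

(** * Linear extension from a basis *)

Section LinearExtension.
Set Implicit Arguments.
Unset Strict Implicit.
Import GRing.Theory.
Local Open Scope fset_scope.
Local Open Scope ring_scope.

Variables (K : fieldType) (M : choiceType) (V : lmodType K).
Implicit Types (h : M -> V) (f : {malg K[M]}).

Definition lin_ext h f : V := \sum_(w <- msupp f) f@_w *: h w.

Lemma lin_extEw (S : {fset M}) h f :
  msupp f `<=` S -> lin_ext h f = \sum_(w <- S) f@_w *: h w.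
Proof.
move=> leS; rewrite /lin_ext; apply: big_fset_incl => // w _ wf.
by rewrite (mcoeff_outdom wf) scale0r.
Qed.

Lemma lin_ext_linear h : linear (lin_ext h).
Proof.
move=> c f g; pose S := msupp f `|` msupp g.
rewrite (@lin_extEw S h f) ?fsubsetUl // (@lin_extEw S h g) ?fsubsetUr //.
rewrite (@lin_extEw S); last first.
  apply: fsubset_trans (msuppD_le _ _) _.
  by rewrite fsetUSS // msuppZ_le.
rewrite scaler_sumr -big_split; apply: eq_bigr => w _ /=.
by rewrite mcoeffD mcoeffZ scalerDl scalerA.
Qed.

Lemma lin_extU h w : lin_ext h << w >> = h w.
Proof. by rewrite /lin_ext msuppU oner_eq0 big_seq_fset1 mcoeffUU scale1r. Qed.

Lemma lin_ext_comb c h1 h2 h f :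
  (forall w, h w = c *: h1 w + h2 w) ->
  lin_ext h f = c *: lin_ext h1 f + lin_ext h2 f.
Proof.
move=> hE; rewrite /lin_ext scaler_sumr -big_split; apply: eq_bigr => w _ /=.
by rewrite hE scalerDr !scalerA mulrC.
Qed.

End LinearExtension.

(** * Words, and induction on the free non-unital algebra *)

Section FreeNonunitalTheory.
Set Implicit Arguments.
Unset Strict Implicit.
Import GRing.Theory.
Local Open Scope fset_scope.
Local Open Scope ring_scope.

Variables (K : fieldType) (X : choiceType).
Local Notation A := (freealg K X).
Local Notation Ap := (freealgp K X).
Local Notation dot := (@freealgp_mul K X).
Local Notation word s := (<< FMonom s >> : A).
Implicit Types (p q : A) (f g h : Ap) (ast : Ap -> Ap -> Ap)
  (star : X -> X -> Ap).

Lemma word_cons (x : X) (s : seq X) : word (x :: s) = (letter K x : A) * word s.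
Proof.
rewrite malgM_def fgmulUU mulr1; congr << _ *g _ >>.
by apply/val_inj; rewrite /= fmM fmU.
Qed.

Lemma word_cat (s t : seq X) : word (s ++ t) = word s * word t.
Proof.
rewrite malgM_def fgmulUU mulr1; congr << _ *g _ >>.
by apply/val_inj; rewrite /= fmM.
Qed.

Lemma letter_word (x : X) : (letter K x : A) = word [:: x].
Proof. by rewrite /= fmuE. Qed.

Lemma word_nil : word [::] = 1.
Proof. by congr << _ *g _ >>; apply/val_inj; rewrite /= fm1. Qed.

Lemma mul_malgCr (c : K) p : p * c%:MP = c *: p.
Proof.
rewrite malgM_def malgZ_def fgmulgU; apply: eq_bigr => k _.
by rewrite mulm1 mulrC.
Qed.

(** Constants are central, as [K] is commutative and the empty word is neutral. *)
Lemma freealg_scalerAr (c : K) p q : p * (c *: q) = c *: (p * q).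
Proof. by rewrite -mul_malgC mulrA mul_malgCr scalerAl. Qed.

Lemma sandwich_subproof p f q : p * (f : A) * q \in supp_nonempty (X := X).
Proof.
case: f => f /= f1; rewrite supp_nonemptyE in f1.
by rewrite supp_nonemptyE !rmorphM /= (eqP f1) mulr0 mul0r.
Qed.

(** [K<X>^+] as a bimodule over the unital algebra [K<X>]; the outer factors of a
product of words, and the coefficients [L] and [R], may be empty words. *)
Definition sandwich p f q : Ap := FreeAlgP (sandwich_subproof p f q).

Lemma freealgp_word_ind (P : Ap -> Prop) :
  P 0 -> (forall c f g, P f -> P g -> P (c *: f + g)) ->
  (forall f x s, (f : A) = word (x :: s) -> P f) ->
  forall f, P f.
Proof.
move=> P0 PD Pw f.
have fw : {in enum_fset (msupp f), forall w, w != mone}.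
  move=> w wf; have := valP f; rewrite -topredE /=.
  by apply: contraNneq => <-.
suff [g gE Pg] : exists2 g : Ap,
    (g : A) = \sum_(w <- msupp f) << (f : A)@_w *g w >> & P g.
  by have -> : f = g by apply/val_inj; rewrite /= gE -monalgE.
elim: (enum_fset (msupp f)) fw => [|w s IH] sw.
  by exists 0; rewrite ?big_nil.
have [|g gE Pg] := IH; first by move=> u us; apply: sw; rewrite inE us orbT.
have w1 : << w >> \in supp_nonempty (K := K) (X := X).
  by rewrite supp_nonemptyE mcoeffU (negbTE (sw w _)) // mem_head.
exists ((f : A)@_w *: FreeAlgP w1 + g).
  rewrite big_cons /= gE; congr (_ + _).
  by apply/malgP => u; rewrite mcoeffZ !mcoeffU mulrnAr mulr1.
apply: PD => //; case: w {sw w1} (sw w (mem_head _ _)) w1 => -[|x t] w1 w1'.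
  by case/eqP: w1; apply/val_inj; rewrite /= fm1.
exact: Pw.
Qed.

(** The letters generate the algebra, since a word of length at least two is the
product of its first letter and a non-empty word. *)
Lemma freealgp_gen_ind (P : Ap -> Prop) :
  P 0 -> (forall c f g, P f -> P g -> P (c *: f + g)) ->
  (forall x, P (letter K x)) -> (forall f g, P f -> P g -> P (dot f g)) ->
  forall f, P f.
Proof.
move=> P0 PD Px PM; apply: freealgp_word_ind => // f x s.
elim: s x f => [|y s IH] x f fE.
  suff -> : f = letter K x by [].
  by apply/val_inj; rewrite /= fE -letter_word.
have s1 : word (y :: s) \in supp_nonempty (K := K) (X := X).
  by rewrite supp_nonemptyE mcoeffU -val_eqE /= fm1.
have -> : f = dot (letter K x) (FreeAlgP s1).
  by apply/val_inj; rewrite /= fE word_cons.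
by apply: PM => //; apply: IH.
Qed.

(** * Products compatible with the bimodule structure *)

Lemma bilinear0l (V : lmodType K) (m : V -> V -> V) :
  bilinear_for *:%R *:%R m -> forall v, m 0 v = 0.
Proof.
by case=> ml _ v; have /= := ml v (-1) 0 0; rewrite scaler0 addr0 scaleN1r addNr.
Qed.

Lemma bilinear0r (V : lmodType K) (m : V -> V -> V) :
  bilinear_for *:%R *:%R m -> forall v, m v 0 = 0.
Proof.
by case=> _ mr v; have /= := mr v (-1) 0 0; rewrite scaler0 addr0 scaleN1r addNr.
Qed.

(** The part of [id_matching] that imposes no condition on the products of letters;
associativity is what remains. *)
Definition module_product ast : Prop :=
  [/\ bilinear_for *:%R *:%R ast,
      forall a b c, dot (ast a b) c = ast a (dot b c)
    & forall a b c, ast (dot a b) c = dot a (ast b c)].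

Lemma id_matchingP ast :
  id_matching dot ast <-> module_product ast /\ associative ast.
Proof. by split=> [[[bl aA] h1 h2]|[[bl h1 h2] aA]]; split=> //; split. Qed.

Section ModuleProduct.
Variable ast : Ap -> Ap -> Ap.
Hypothesis astP : module_product ast.

Lemma astDl c f g h : ast (c *: f + g) h = c *: ast f h + ast g h.
Proof. by have [[/(_ h) l _] _ _] := astP; exact: l. Qed.

Lemma astDr c f g h : ast h (c *: f + g) = c *: ast h f + ast h g.
Proof. by have [[_ /(_ h) l] _ _] := astP; exact: l. Qed.

Lemma ast0l h : ast 0 h = 0.
Proof. by have [/bilinear0l-> _ _] := astP. Qed.

Lemma ast0r h : ast h 0 = 0.
Proof. by have [/bilinear0r-> _ _] := astP. Qed.

Lemma dot_astl f g h : ast (dot f g) h = dot f (ast g h).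
Proof. by have [_ _ ->] := astP. Qed.

Lemma dot_astr f g h : ast f (dot g h) = dot (ast f g) h.
Proof. by have [_ -> _] := astP. Qed.

(** The mixed laws concern non-unital factors; a factor [p] of [K<X>] is its
constant coefficient, treated by linearity, plus an element of [K<X>^+]. *)
Lemma ast_sandwichl p f g : ast (sandwich p f 1) g = sandwich p (ast f g) 1.
Proof.
have p1 : p - (p@_mone)%:MP \in supp_nonempty (K := K) (X := X).
  by rewrite supp_nonemptyE mcoeffB malgCK subrr.
have sandwichE h : sandwich p h 1 = p@_mone *: h + dot (FreeAlgP p1) h.
  by apply/val_inj; rewrite /= mulr1 mulrBl mul_malgC addrC subrK.
by rewrite !sandwichE astDl dot_astl.
Qed.

Lemma ast_sandwichr q f g : ast g (sandwich 1 f q) = sandwich 1 (ast g f) q.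
Proof.
have q1 : q - (q@_mone)%:MP \in supp_nonempty (K := K) (X := X).
  by rewrite supp_nonemptyE mcoeffB malgCK subrr.
have sandwichE h : sandwich 1 h q = q@_mone *: h + dot h (FreeAlgP q1).
  by apply/val_inj; rewrite /= mul1r mulrBr mul_malgCr addrC subrK.
by rewrite !sandwichE astDr dot_astr.
Qed.

(** Partial sums of the decomposition stay in [K<X>^+], because each term is a
sandwich; this is what allows the induction on [s]. *)
Lemma ast_suml (s : seq X) (L : X -> A) f g :
  (f : A) = \sum_(v <- s) L v * (letter K v : A) ->
  (ast f g : A) = \sum_(v <- s) L v * (ast (letter K v) g : A).
Proof.
elim: s f => [|v s IH] f.
  rewrite !big_nil => f0; have -> : f = 0 by apply/val_inj.
  by rewrite ast0l.
rewrite !big_cons => fE.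
set t := sandwich (L v) (letter K v) 1.
have -> : f = 1 *: t + (f - t) by rewrite scale1r addrC subrK.
rewrite astDl scale1r /= -(IH (f - t)); last by rewrite /= fE mulr1 addrC addKr.
by rewrite ast_sandwichl /= mulr1.
Qed.

Lemma ast_sumr (s : seq X) (R : X -> A) f g :
  (f : A) = \sum_(u <- s) (letter K u : A) * R u ->
  (ast g f : A) = \sum_(u <- s) (ast g (letter K u) : A) * R u.
Proof.
elim: s f => [|u s IH] f.
  rewrite !big_nil => f0; have -> : f = 0 by apply/val_inj.
  by rewrite ast0r.
rewrite !big_cons => fE.
set t := sandwich 1 (letter K u) (R u).
have -> : f = 1 *: t + (f - t) by rewrite scale1r addrC subrK.
rewrite astDr scale1r /= -(IH (f - t)); last by rewrite /= fE mul1r addrC addKr.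
by rewrite ast_sandwichr /= mul1r.
Qed.

(** Both sides are left linear in [a] and right linear in [c], which reduces these
two to letters. For the middle factor no induction hypothesis is needed on a
product: there both bracketings equal [(a * f) . (g * c)]. *)
Lemma associative_on_letters :
  (forall x y z, ast (letter K x) (ast (letter K y) (letter K z))
               = ast (ast (letter K x) (letter K y)) (letter K z)) ->
  associative ast.
Proof.
move=> astA a b c; elim/freealgp_gen_ind: a b c => [b c|k f g Pf Pg b c|x b c|].
- by rewrite !ast0l.
- by rewrite !astDl Pf Pg.
- elim/freealgp_gen_ind: c b => [b|k f g Pf Pg b|z b|].
  + by rewrite !ast0r.
  + by rewrite !astDr Pf Pg.
  + elim/freealgp_gen_ind: b => [|k f g Pf Pg|y|f g _ _].
    * by rewrite !(ast0l, ast0r).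
    * by rewrite !(astDl, astDr) Pf Pg.
    * exact: astA.
    * by rewrite dot_astl !dot_astr dot_astl.
  + by move=> f g Pf Pg b; rewrite !dot_astr Pf.
- by move=> f g Pf Pg b c; rewrite !dot_astl Pg.
Qed.

End ModuleProduct.

Lemma module_product_inj ast1 ast2 :
  module_product ast1 -> module_product ast2 ->
  letter_restriction ast1 =2 letter_restriction ast2 -> ast1 =2 ast2.
Proof.
move=> P1 P2 eq12 a b; elim/freealgp_gen_ind: a b => [b|k f g Pf Pg b|x b|].
- by rewrite (ast0l P1) (ast0l P2).
- by rewrite (astDl P1) (astDl P2) Pf Pg.
- elim/freealgp_gen_ind: b => [|k f g Pf Pg|y|f g Pf Pg].
  + by rewrite (ast0r P1) (ast0r P2).
  + by rewrite (astDr P1) (astDr P2) Pf Pg.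
  + exact: eq12.
  + by rewrite (dot_astr P1) (dot_astr P2) Pf.
- by move=> f g Pf Pg b; rewrite (dot_astl P1) (dot_astl P2) Pg.
Qed.

(** * Left and right coefficients *)

Section Coefficients.
Local Notation coefs := {fsfun X -> freealg K X with 0}.
Implicit Types (R : coefs) (F : X -> A -> A).

Lemma finsupp_sumEw (S : {fset X}) F R :
  (forall u, F u 0 = 0) -> finsupp R `<=` S ->
  \sum_(u <- finsupp R) F u (R u) = \sum_(u <- S) F u (R u).
Proof.
by move=> F0 leS; apply: big_fset_incl => // u _ uR; rewrite fsfun_dflt.
Qed.

(** [F u] stands for multiplication by the letter [u], on the left or on the
right, so that both decompositions of [K<X>^+] are obtained at once. *)
Lemma finsupp_sum_comb F (F_lin : forall u, linear (F u)) c R1 R2 :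
  exists R, \sum_(u <- finsupp R) F u (R u) =
    c *: (\sum_(u <- finsupp R1) F u (R1 u)) + \sum_(u <- finsupp R2) F u (R2 u).
Proof.
have F0 u : F u 0 = 0.
  by rewrite -[0 in LHS](subrr 0) -scaleN1r addrC F_lin scaleN1r addNr.
pose S := finsupp R1 `|` finsupp R2.
exists [fsfun u in S => c *: R1 u + R2 u].
rewrite (@finsupp_sumEw S F R1) ?fsubsetUl // (@finsupp_sumEw S F R2) ?fsubsetUr //.
rewrite (@finsupp_sumEw S) //; last first.
  by apply/fsubsetP => u; rewrite finsupp_fsfun !inE => /andP[].
rewrite scaler_sumr -big_split [LHS]big_seq [RHS]big_seq /=.
by apply: eq_bigr => u uS; rewrite fsfunE uS F_lin.
Qed.

Lemma finsupp_sum_single F (F_lin : forall u, linear (F u)) x p :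
  exists R, \sum_(u <- finsupp R) F u (R u) = F x p.
Proof.
have F0 u : F u 0 = 0.
  by rewrite -[0 in LHS](subrr 0) -scaleN1r addrC F_lin scaleN1r addNr.
exists [fsfun u in [fset x] => p].
rewrite (@finsupp_sumEw [fset x]) //; last first.
  by apply/fsubsetP => u; rewrite finsupp_fsfun !inE => /andP[].
by rewrite big_seq_fset1 fsfunE inE eqxx.
Qed.

Lemma finsupp_sum_span F (F_lin : forall u, linear (F u)) :
  (forall x s, exists u p, word (x :: s) = F u p) ->
  forall f, exists R, (f : A) = \sum_(u <- finsupp R) F u (R u).
Proof.
move=> Fw; elim/freealgp_word_ind => [|c f g [R1 E1] [R2 E2]|f x s ->].
- by exists [fsfun]; rewrite finsupp0 big_nil.
- by have [R RE] := finsupp_sum_comb F_lin c R1 R2; exists R; rewrite RE /= E1 E2.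
- have [u [p ->]] := Fw x s.
  by have [R RE] := finsupp_sum_single F_lin u p; exists R.
Qed.

Lemma right_coefs f :
  exists R : coefs,
    (f : A) = \sum_(u <- finsupp R) (letter K u : A) * R u.
Proof.
apply: (@finsupp_sum_span (fun u (p : A) => (letter K u : A) * p)) => [u c p q|x s].
  by rewrite mulrDr freealg_scalerAr.
by exists x, (word s); rewrite word_cons.
Qed.

Lemma left_coefs f :
  exists L : coefs,
    (f : A) = \sum_(v <- finsupp L) L v * (letter K v : A).
Proof.
apply: (@finsupp_sum_span (fun u (p : A) => p * (letter K u : A))) => [u c p q|x s].
  by rewrite mulrDl scalerAl.
exists (last x s), (word (belast x s)).
by rewrite letter_word -word_cat cats1 -lastI.
Qed.

End Coefficients.

(** * Associativity and the compatibility condition *)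

(** The two sums of the compatibility condition are [(x * y) * z] and
[x * (y * z)], whatever coefficient families represent [x * y] and [y * z]. *)
Lemma star_compatible_assoc ast : module_product ast ->
  star_compatible (letter_restriction ast) <-> associative ast.
Proof.
move=> astP; split=> [[R [L [RE LE RL]]]|astA].
  apply: (associative_on_letters astP) => x y z; apply/val_inj => /=.
  by rewrite (ast_sumr astP _ (RE y z)) (ast_suml astP _ (LE x y)) RL.
have [R RE] := boolp.choice (fun xy : X * X =>
  right_coefs (letter_restriction ast xy.1 xy.2)).
have [L LE] := boolp.choice (fun xy : X * X =>
  left_coefs (letter_restriction ast xy.1 xy.2)).
exists (fun x y => R (x, y)), (fun x y => L (x, y)).
split=> [x y|x y|x y z]; first exact: (RE (x, y)); first exact: (LE (x, y)).
rewrite -(ast_sumr astP _ (RE (y, z))) -(ast_suml astP _ (LE (x, y))).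
by rewrite /letter_restriction astA.
Qed.

(** * Extending a map on letters *)

(** On words [s x] and [y t] the value is [s (star x y) t]; reversing the first
word exposes its last letter. *)
Definition word_star star (u v : {fmonom X}) : Ap :=
  match rev u, v : seq X with
  | x :: s, y :: t => sandwich (word (rev s)) (star x y) (word t)
  | _, _ => 0
  end.

Definition extend_star star f g : Ap :=
  lin_ext (fun u => lin_ext (word_star star u) (g : A)) (f : A).

Lemma extend_star_bilinear star : bilinear_for *:%R *:%R (extend_star star).
Proof.
split=> [g c f1 f2|f c g1 g2]; rewrite /extend_star; first exact: lin_ext_linear.
by apply: lin_ext_comb => w; apply: lin_ext_linear.
Qed.

Lemma extend_star_words star f g x y s t :
  (f : A) = word (rcons s x) -> (g : A) = word (y :: t) ->
  extend_star star f g = sandwich (word s) (star x y) (word t).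
Proof.
move=> fE gE; rewrite /extend_star fE gE !lin_extU /word_star /= rev_rcons.
by rewrite revK.
Qed.

Lemma extend_star_letters star :
  letter_restriction (extend_star star) =2 star.
Proof.
move=> x y; rewrite /letter_restriction.
rewrite (@extend_star_words _ _ _ x y [::] [::]) ?letter_word //.
by apply/val_inj; rewrite /= word_nil mulr1 mul1r.
Qed.

(** By bilinearity it suffices to look at words, where [s (x * y) t z r] is read
as the product with [y t z r], and symmetrically on the left. *)
Lemma extend_star_module star : module_product (extend_star star).
Proof.
have extB := extend_star_bilinear star.
have [dotB _] := freealgp_mul_assoc_product K X.
have [e0l e0r] := (bilinear0l extB, bilinear0r extB).
have [d0l d0r] := (bilinear0l dotB, bilinear0r dotB).
have [extl extr] := extB; have [dotl dotr] := dotB.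
split=> // a b c.
- elim/freealgp_word_ind: a => [|k f g Pf Pg|a x s aE]; rewrite ?(e0l, d0l) //.
    by rewrite !extl dotl Pf Pg.
  elim/freealgp_word_ind: b => [|k f g Pf Pg|b y t bE].
  + by rewrite !(e0r, d0l).
  + by rewrite extr !dotl extr Pf Pg.
  elim/freealgp_word_ind: c => [|k f g Pf Pg|c z r cE].
  + by rewrite !(e0r, d0r).
  + by rewrite !dotr extr Pf Pg.
  rewrite lastI in aE; rewrite (extend_star_words star aE bE).
  have bcE : (dot b c : A) = word (y :: t ++ z :: r).
    by rewrite /= bE cE -word_cat.
  rewrite (extend_star_words star aE bcE); apply/val_inj => /=.
  by rewrite cE word_cat !mulrA.
- elim/freealgp_word_ind: c => [|k f g Pf Pg|c x s cE].
  + by rewrite !(e0r, d0r).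
  + by rewrite !extr dotr Pf Pg.
  elim/freealgp_word_ind: b => [|k f g Pf Pg|b y t bE].
  + by rewrite !(d0r, e0l, d0r).
  + by rewrite extl !dotr extl Pf Pg.
  elim/freealgp_word_ind: a => [|k f g Pf Pg|a z r aE].
  + by rewrite !(d0l, e0l).
  + by rewrite !dotl extl Pf Pg.
  rewrite lastI in bE; rewrite (extend_star_words star bE cE).
  have abE : (dot a b : A) = word (rcons (z :: r ++ belast y t) (last y t)).
    by rewrite /= aE bE -word_cat -rcons_cat.
  rewrite (extend_star_words star abE cE); apply/val_inj => /=.
  by rewrite aE -cat_cons word_cat !mulrA.
Qed.

End FreeNonunitalTheory.

(** * The correspondence *)

Theorem proposition4p2 (K : fieldType) (X : choiceType)
    (X_gt1 : exists x y : X, x <> y) :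
  functions.set_bij
    (@id_matching K (freealgp K X) (@freealgp_mul K X))
    (@star_compatible K X)
    (@letter_restriction K X).
Proof.
split.
- by move=> ast /id_matchingP[astP] /(star_compatible_assoc astP).
- move=> ast1 ast2; rewrite !classical_sets.in_setE => /id_matchingP[P1 _].
  move=> /id_matchingP[P2 _] eq12.
  do 2!apply: boolp.funext => ?; apply: (module_product_inj P1 P2).
  by move=> x y; rewrite eq12.
- move=> star starP; have extE : letter_restriction (extend_star star) = star.
    by do 2!apply: boolp.funext => ?; apply: extend_star_letters.
  exists (extend_star star) => //; apply/id_matchingP.
  have astP := extend_star_module star; split=> //.
  by apply/(star_compatible_assoc astP); rewrite extE.
Qed.
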